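(* Let $\psi: T \to \mathbb{C}$ be a function and $\varphi: T \to T$ a self-map. Then $W_{\psi,\varphi}$ is bounded on $L_\mu^\infty$ if and only if $$\sigma_{\psi,\varphi} := \sup_{v \in T} \frac{\mu(v)}{\mu(\varphi(v))}|\psi(v)|$$ is finite. Moreover, in this case the operator norm of $W_{\psi,\varphi}$ on $L_\mu^\infty$ satisfies $\|W_{\psi,\varphi}\| = \sigma_{\psi,\varphi}$.
   Context: $(T,\mathrm{d})$ is a metric space with a distinguished point $o$ (the root); the length of $v \in T$ is $|v| = \mathrm{d}(o,v)$. $T$ is assumed locally finite (for every $M>0$ the set $\{v \in T : |v| < M\}$ is finite) and unbounded (for every $M>0$ there is $v \in T$ with $|v| \ge M$). $\mu: T \to (0,\infty)$ is an arbitrary positive function (a weight). $L_\mu^\infty$ is the Banach space of functions $f: T \to \mathbb{C}$ with $\|f\|_\mu = \sup_{v \in T} \mu(v)|f(v)| < \infty$. The weighted composition operator is the linear map $W_{\psi,\varphi} f = \psi\,(f\circ\varphi)$; it is bounded on $L_\mu^\infty$ if it is a bounded operator from $L_\mu^\infty$ to itself. *)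

(* Defs.v *)
From HB Require Import structures.
From mathcomp Require Import all_boot all_order all_algebra.
From mathcomp Require Import all_classical all_reals all_analysis.
From mathcomp Require Export complex.

Set Implicit Arguments.
Unset Strict Implicit.
Unset Printing Implicit Defensive.

Import Order.TTheory GRing.Theory Num.Theory.

Local Open Scope classical_set_scope.
Local Open Scope ring_scope.

Section rooted_metric_space.
Context {R : realType} {T : metricType R}.
Variable o : T.

Definition len (v : T) : R := mdist o v.

Definition locally_finite := forall M : R, 0 < M -> finite_set [set v | len v < M].

Definition unbounded := forall M : R, 0 < M -> exists v, M <= len v.

End rooted_metric_space.

Section weighted_space.
Context {R : realType} {T : Type}.
Variable mu : T -> R.

(* [`|z|] on [R[i]] is itself [R[i]]-valued; [Normc.normc] is the same modulus
   with values in [R]. *)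
Definition wnorm (f : T -> R[i]) : \bar R :=
  ereal_sup [set (mu v * Normc.normc (f v))%:E | v in [set: T]].

Definition Linfty : set (T -> R[i]) := [set f | (wnorm f < +oo)%E].

(* Operators are defined on all functions, so that boundedness on [Linfty]
   includes its stability. *)
Definition bounded_on_Linfty (A : {linear (T -> R[i]) -> (T -> R[i])}) : Prop :=
  (forall f, Linfty f -> Linfty (A f)) /\
  exists M : R, forall f, Linfty f -> (wnorm (A f) <= M%:E * wnorm f)%E.

Definition opnorm (A : {linear (T -> R[i]) -> (T -> R[i])}) : \bar R :=
  ereal_sup [set wnorm (A f) | f in [set f | Linfty f /\ (wnorm f <= 1)%E]].

End weighted_space.

Section weighted_composition.
Context {R : realType} {T : Type}.
Variables (psi : T -> R[i]) (phi : T -> T).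

Definition wcomp (f : T -> R[i]) : T -> R[i] := fun v => psi v * f (phi v).

Lemma wcomp_is_linear : linear wcomp.
Proof.
move=> a f g; apply/funext => v; rewrite /wcomp !fctE mulrDr.
by congr (_ + _); exact: mulrCA.
Qed.

HB.instance Definition _ := GRing.isLinear.Build R[i] (T -> R[i]) (T -> R[i])
  *:%R wcomp wcomp_is_linear.

Definition sigma (mu : T -> R) : \bar R :=
  ereal_sup [set (mu v / mu (phi v) * Normc.normc (psi v))%:E | v in [set: T]].

End weighted_composition.

(* Main.v *)
(** Writing [mu v |psi v| |f (phi v)|] as the product of the [v]-term of [sigma]
    and the [phi v]-term of the norm of [f] bounds the operator norm by [sigma].
    Conversely, the single test function [1 / mu] has norm at most [1], and its
    image under the operator has norm exactly [sigma]. *)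
Require Import Defs.
From mathcomp Require Import all_boot all_order all_algebra.
From mathcomp Require Import all_classical all_reals all_analysis.

Set Implicit Arguments.
Unset Strict Implicit.
Unset Printing Implicit Defensive.

Import Order.TTheory GRing.Theory Num.Theory.

Local Open Scope ring_scope.

Lemma normc_ge0 (R : rcfType) (z : R[i]) : 0 <= Normc.normc z.
Proof. by case: z => a b; rewrite sqrtr_ge0. Qed.

Lemma normc_real (R : rcfType) (a : R) : Normc.normc a%:C%C = `|a|.
Proof. by rewrite /Normc.normc /= expr0n addr0 sqrtr_sqr. Qed.

Section weighted_composition_norm.
Variables (R : realType) (T : Type) (mu : T -> R).
Hypothesis mu_gt0 : forall v, 0 < mu v.

(** The point [v] witnesses that [T] is inhabited; over an empty type the supremum would be
    [-oo]. *)
Lemma sigma_ge0 (v : T) (psi : T -> R[i]) (phi : T -> T) :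
  (0 <= sigma psi phi mu)%E.
Proof.
apply: (@le_trans _ _ (mu v / mu (phi v) * Normc.normc (psi v))%:E).
  by rewrite lee_fin mulr_ge0 ?normc_ge0 // divr_ge0 // ltW.
by apply: ereal_sup_ubound; exists v.
Qed.

(** Working in the extended reals, one estimate serves for stability, for the bound and for the
    upper half of the norm identity. *)
Lemma wnorm_wcomp_le (psi : T -> R[i]) (phi : T -> T) (f : T -> R[i]) :
  (wnorm mu (wcomp psi phi f) <= sigma psi phi mu * wnorm mu f)%E.
Proof.
apply: ge_ereal_sup => _ [v _ <-].
have -> : mu v * Normc.normc (wcomp psi phi f v) =
    (mu v / mu (phi v) * Normc.normc (psi v)) *
    (mu (phi v) * Normc.normc (f (phi v))).
  rewrite /wcomp Normc.normcM mulrACA divfK ?gt_eqF //; exact: mulrA.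
rewrite EFinM; apply: lee_pmul.
- by rewrite lee_fin mulr_ge0 ?normc_ge0 // divr_ge0 // ltW.
- by rewrite lee_fin mulr_ge0 ?normc_ge0 // ltW.
- by apply: ereal_sup_ubound; exists v.
- by apply: ereal_sup_ubound; exists (phi v).
Qed.

Definition inv_weight (v : T) : R[i] := ((mu v)^-1)%:C%C.

Lemma normc_inv_weight (v : T) : Normc.normc (inv_weight v) = (mu v)^-1.
Proof. by rewrite normc_real gtr0_norm // invr_gt0. Qed.

(** Every term of the supremum equals 1; an empty [T] would give [-oo], hence the inequality. *)
Lemma wnorm_inv_weight_le1 : (wnorm mu inv_weight <= 1)%E.
Proof.
apply: ge_ereal_sup => _ [v _ <-].
by rewrite normc_inv_weight mulfV ?gt_eqF.
Qed.

Lemma Linfty_inv_weight : Linfty mu inv_weight.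
Proof. by apply: le_lt_trans wnorm_inv_weight_le1 _; rewrite ltry. Qed.

(** The modulus of [inv_weight] at [phi v] is the denominator in [sigma], so both suprema run over
    the same terms, whether finite or not. *)
Lemma wnorm_wcomp_inv_weight (psi : T -> R[i]) (phi : T -> T) :
  wnorm mu (wcomp psi phi inv_weight) = sigma psi phi mu.
Proof.
congr ereal_sup; apply: eq_imagel => v _.
by rewrite /wcomp Normc.normcM normc_inv_weight mulrA mulrAC.
Qed.

End weighted_composition_norm.

Theorem theorem3p2 (R : realType) (T : metricType R) (o : T)
  (T_locally_finite : locally_finite o) (T_unbounded : unbounded o)
  (mu : T -> R) (mu_gt0 : forall v, 0 < mu v)
  (psi : T -> R[i]) (phi : T -> T) :
  (bounded_on_Linfty mu (wcomp psi phi) <-> (sigma psi phi mu < +oo)%E) /\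
  (bounded_on_Linfty mu (wcomp psi phi) ->
    opnorm mu (wcomp psi phi) = sigma psi phi mu).
Proof.
(* The root [o] supplies the required point. *)
have sigma0 := sigma_ge0 mu_gt0 o psi phi.
split; first split.
- move=> [stable _]; rewrite -(wnorm_wcomp_inv_weight mu_gt0).
  exact/stable/Linfty_inv_weight.
- move=> sigma_fin.
  (* Being nonnegative and below [+oo], [sigma] is a real number, which is the constant [M]
     below. *)
  have sigmaE : ((fine (sigma psi phi mu))%:E = sigma psi phi mu)%E.
    by rewrite fineK // ge0_fin_numE.
  split=> [f f_fin|].
    apply: le_lt_trans (wnorm_wcomp_le mu_gt0 psi phi f) _.
    by apply: lte_mul_pinfty; rewrite ?ge0_fin_numE.
  by exists (fine (sigma psi phi mu)) => f _; rewrite sigmaE wnorm_wcomp_le.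
- move=> _; apply/eqP; rewrite eq_le; apply/andP; split.
    apply: ge_ereal_sup => _ [f [_ f_le1] <-].
    apply: le_trans (wnorm_wcomp_le mu_gt0 psi phi f) _.
    by rewrite -[leRHS]mule1 lee_wpmul2l.
  (* The supremum defining [opnorm] is attained at [inv_weight mu], a member of the unit ball. *)
  rewrite -(wnorm_wcomp_inv_weight mu_gt0); apply: ereal_sup_ubound.
  exists (inv_weight mu) => //; split; first exact: Linfty_inv_weight.
  exact: wnorm_inv_weight_le1.
Qed.
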